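(* Let $(\mathcal{K},\prec_{\mathcal{K}})$ be a Metric Abstract Elementary Class with metric Löwenheim–Skolem number $LS(\mathcal{K})$. If $\langle M_i : i\in I\rangle$ is a sequence of structures in $\mathcal{K}$ and $U$ is an $LS(\mathcal{K})^+$-complete ultrafilter on $I$, then the metric ultraproduct $\prod^d_U M_i$ belongs to $\mathcal{K}$.
   Context: Structures are $L$-structures of continuous logic: complete metric spaces with interpretations of the symbols of $L$ (uniform continuity is not required). For a subset $A$ of a metric space, $dc(A)$ is the density character (least cardinality of a dense subset) of its closure. A Metric Abstract Elementary Class (MAEC) is a class $\mathcal{K}$ of such $L$-structures with a binary relation $\prec_{\mathcal{K}}$ such that: (1) $\mathcal{K}$ and $\prec_{\mathcal{K}}$ are closed under isomorphism; (2) $\prec_{\mathcal{K}}$ is a partial order on $\mathcal{K}$; (3) $M\prec_{\mathcal{K}}N$ implies $M\subseteq N$; (4) for every $\prec_{\mathcal{K}}$-increasing chain $(M_i:i<\lambda)$: (a) the function symbols of $L$ can be uniquely interpreted on the metric completion $\overline{\bigcup_{i<\lambda}M_i}$ so that it lies in $\mathcal{K}$, (b) $M_j\prec_{\mathcal{K}}\overline{\bigcup_{i<\lambda}M_i}$ for each $j<\lambda$, (c) if each $M_i\prec_{\mathcal{K}}N$ then $\overline{\bigcup_{i<\lambda}M_i}\prec_{\mathcal{K}}N$; (5) (coherence) if $M_1\subseteq M_2\prec_{\mathcal{K}}M_3$ and $M_1\prec_{\mathcal{K}}M_3$ then $M_1\prec_{\mathcal{K}}M_2$; (6) there is an infinite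 cardinal $LS(\mathcal{K})$ such that for all $M\in\mathcal{K}$ and $A\subseteq M$ there is $N\in\mathcal{K}$ with $A\subseteq N\prec_{\mathcal{K}}M$ and $dc(N)\le dc(A)+LS(\mathcal{K})$. Metric ultraproduct: for a countably complete ultrafilter $U$ on $I$ and metric spaces $(M_i,d_i)$, define on $\prod_{i\in I}M_i$ the function $d((x_i),(y_i)):=\lim_U d_i(x_i,y_i)$ (the $U$-limit, which is a real number by countable completeness), identify sequences at distance $0$, obtaining a complete metric space; interpreting the symbols of $L$ coordinatewise (function symbols coordinatewise, predicate values as $U$-limits) gives the continuous $L$-structure $\prod^d_U M_i$.
   Formalization: LS(K) is additionally assumed to be at least the number of symbols of L; without this the claim fails (given a measurable cardinal μ, take discrete structures where each point satisfies one of μ unary predicates). Symbols are read as continuous and structures as nonempty. *)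

(* Defs.v *)
From HB Require Import structures.
From mathcomp Require Import all_boot all_order all_algebra.
From mathcomp Require Import all_classical all_reals.
From mathcomp Require Import topology function_spaces normedtype.
From mathcomp Require wochoice.

Set Implicit Arguments.
Unset Strict Implicit.
Unset Printing Implicit Defensive.

Import Order.TTheory GRing.Theory Num.Theory.
Import numFieldNormedType.Exports.

Local Open Scope classical_set_scope.
Local Open Scope card_scope.
Local Open Scope ring_scope.
Local Open Scope quotient_scope.

(* Complete metric spaces.  They are pointed because `Complete` extends
   `Pointed`: this makes every space nonempty, and the base point plays no
   other role. *)
#[short(type="completeMetricType")]
HB.structure Definition CompleteMetric (R : numDomainType) :=
  {T of Complete T & Metric R T}.

Record language := Language {
  fsym : Type;
  psym : Type;
  farity : fsym -> nat;
  parity : psym -> nat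
}.

(* Continuous, but not necessarily uniformly continuous, interpretations of the
   symbols.  Predicates are real-valued and no bound is imposed on them. *)
Record interpretation (R : realType) (L : language) (T : completeMetricType R) :=
  Interpretation {
    fint : forall s : fsym L, {ptws 'I_(farity s) -> T} -> T;
    pint : forall p : psym L, {ptws 'I_(parity p) -> T} -> R;
    fint_continuous : forall s, continuous (@fint s);
    pint_continuous : forall p, continuous (@pint p)
  }.

Record structure (R : realType) (L : language) := Structure {
  carrier :> completeMetricType R;
  interp :> interpretation L carrier
}.

Section Morphisms.
Context (R : realType) (L : language).
Implicit Types M N : structure R L.

Definition isometry (T T' : metricType R) (f : T -> T') : Prop :=
  forall x y, mdist (f x) (f y) = mdist x y.

Record embedding M N (f : M -> N) : Prop := Embedding {
  embedding_isometry : isometry f;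
  embedding_fint : forall (s : fsym L) (x : 'I_(farity s) -> M),
    f (fint M x) = fint N (f \o x);
  embedding_pint : forall (p : psym L) (x : 'I_(parity p) -> M),
    pint N (f \o x) = pint M x
}.

Definition isomorphism M N (f : M -> N) : Prop := embedding f /\ bijective f.

End Morphisms.

Section MetricAEC.
Context (R : realType) (L : language).
Implicit Types M N : structure R L.

(* There is no literal inclusion between types, so the relation is recorded on
   maps: `strong f` says that f is an isomorphism of M onto a substructure f(M)
   of N with f(M) <= N for the order of the class; "M is a strong substructure
   of N" is the case where f is the inclusion. *)
Record structure_class := StructureClass {
  member :> structure R L -> Prop;
  strong : forall M N : structure R L, (M -> N) -> Prop
}.

(* An increasing chain indexed by a nonzero ordinal; the equations on the
   transition maps hold trivially for inclusions. *)
Record increasing_chain (K : structure_class) (J : Type) (le : rel J)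
    (M : J -> structure R L) (e : forall i j, le i j -> M i -> M j) : Prop :=
  IncreasingChain {
    chain_inhabited : inhabited J;
    chain_well_order : wochoice.well_order le;
    chain_member : forall i, K (M i);
    chain_strong : forall i j (ij : le i j), strong K (e i j ij);
    chain_refl : forall i (ii : le i i) x, e i i ii x = x;
    chain_trans : forall i j k (ij : le i j) (jk : le j k) (ik : le i k) x,
      e j k jk (e i j ij x) = e i k ik x
  }.

Definition compatible (J : Type) (le : rel J) (M : J -> structure R L)
    (e : forall i j, le i j -> M i -> M j) (T : Type) (c : forall j, M j -> T) :=
  forall i j (ij : le i j) x, c j (e i j ij x) = c i x.

(* T, with the maps c, is the metric completion of the union of the chain. *)
Record chain_completion (J : Type) (le : rel J) (M : J -> structure R L)
    (e : forall i j, le i j -> M i -> M j)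
    (T : completeMetricType R) (c : forall j, M j -> T) : Prop :=
  ChainCompletion {
    completion_compatible : compatible e c;
    completion_isometry : forall j, isometry (c j);
    completion_dense : dense (\bigcup_j range (c j))
  }.

Definition interprets_completion (K : structure_class) (J : Type)
    (M : J -> structure R L) (T : completeMetricType R)
    (c : forall j, M j -> T) (s : interpretation L T) : Prop :=
  (forall j, @embedding R L (M j) (Structure s) (c j)) /\ K (Structure s).

(* D is a dense subset of least cardinality of the closure of A: the density
   character of A is the cardinality of D. *)
Definition density_character (T : topologicalType) (A D : set T) : Prop :=
  [/\ D `<=` closure A,
      closure A `<=` closure D &
      forall E : set T, E `<=` closure A -> closure A `<=` closure E -> D #<= E].

(* dc(A) <= dc(B) + |kappa| *)
Definition dc_le_add (T T' : topologicalType) (A : set T) (B : set T')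
    (kappa : Type) : Prop :=
  exists (D : set T) (E : set T'),
    [/\ density_character A D, density_character B E &
        D #<= (inl @` E `|` inr @` [set: kappa] : set (T' + kappa))].

(* A type kappa stands for its cardinality.  As usual for abstract elementary
   classes, LS(K) is taken to be at least the number of symbols of L.  Any kappa
   can be enlarged to meet LS_language, so this does not restrict the classes
   below; but the ultraproduct theorem needs it: take discrete structures in
   which every point satisfies one of mu unary predicates, mu measurable. *)
Record is_LS_number (K : structure_class) (kappa : Type) : Prop := IsLSNumber {
  LS_infinite : infinite_set [set: kappa];
  LS_language : [set: fsym L + psym L] #<= [set: kappa];
  LS_downward : forall M, K M -> forall A : set M,
    exists N (f : N -> M), [/\ K N, strong K f, A `<=` range f &
      dc_le_add [set: N] A kappa]
}.

(* Antisymmetry of the order needs no axiom: it holds for inclusions. *)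
Record is_MAEC (K : structure_class) : Prop := IsMAEC {
  member_iso : forall M M' (g : M -> M'), isomorphism g -> K M -> K M';
  strong_iso : forall M N M' N' (f : M -> N) (f' : M' -> N')
      (g : M -> M') (h : N -> N'),
    isomorphism g -> isomorphism h -> (forall x, f' (g x) = h (f x)) ->
    strong K f -> strong K f';
  strong_member : forall M N (f : M -> N), strong K f -> K M /\ K N;
  strong_refl : forall M, K M -> strong K (@id M);
  strong_trans : forall M1 M2 M3 (f : M1 -> M2) (g : M2 -> M3),
    strong K f -> strong K g -> strong K (g \o f);
  strong_embedding : forall M N (f : M -> N), strong K f -> embedding f;
  chain_union : forall (J : Type) (le : rel J) (M : J -> structure R L)
      (e : forall i j, le i j -> M i -> M j)
      (T : completeMetricType R) (c : forall j, M j -> T),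
    increasing_chain K e -> chain_completion e c ->
    exists s : interpretation L T,
      [/\ unique (interprets_completion K c) s,
          forall j, @strong K (M j) (Structure s) (c j) &
          forall N (g : forall j, M j -> N) (h : T -> N),
            compatible e g -> (forall j, strong K (g j)) ->
            isometry h -> (forall j x, h (c j x) = g j x) ->
            @strong K (Structure s) N h];
  coherence : forall M1 M2 M3 (f : M1 -> M2) (g : M2 -> M3),
    embedding f -> strong K g -> strong K (g \o f) -> strong K f;
  downward_LS : exists kappa : Type, is_LS_number K kappa
}.

End MetricAEC.

Definition countably_complete (I : Type) (U : set_system I) : Prop :=
  forall A : nat -> set I, (forall n, U (A n)) -> U (\bigcap_n A n).

(* |kappa|^+-completeness: fewer than |kappa|^+ sets are at most |kappa|. *)
Definition succ_complete (kappa I : Type) (U : set_system I) : Prop :=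
  forall G : set_system I, G `<=` U -> G #<= [set: kappa] ->
    U (\bigcap_(A in G) A).

Lemma succ_complete_countably (kappa I : Type) (U : set_system I) :
  infinite_set [set: kappa] -> succ_complete kappa U -> countably_complete U.
Proof.
move=> /infiniteP kinf Uk A UA.
rewrite -[\bigcap_n A n](@bigcap_image _ _ _ setT A id).
apply: Uk => [_ [n _ <-] //|].
exact: card_le_trans (card_image_le _ _) kinf.
Qed.

Lemma nbhs_ptwsP (R : realType) (T : pseudoMetricType R) (n : nat)
    (x : {ptws 'I_n -> T}) (A : set {ptws 'I_n -> T}) :
  nbhs x A <-> exists2 d : R, 0 < d &
    forall y : {ptws 'I_n -> T}, (forall k, ball (x k) d (y k)) -> A y.
Proof.
pose box (d : R) := [set y : {ptws 'I_n -> T} | forall k, ball (x k) d (y k)].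
split=> [|[d d0 dA]].
  have FF : Filter (filter_from [set d : R | 0 < d] box).
    apply: filter_from_filter; first by exists 1 => /=.
    move=> d e d0 e0; exists (Num.min d e); first by rewrite /= lt_min d0.
    move=> y xy; split=> k; apply: le_ball (xy k); rewrite ge_min lexx ?orbT//.
  suff : filter_from [set d : R | 0 < d] box --> x.
    by move=> /[apply] -[d d0 dA]; exists d.
  apply/cvg_sup => k B [_ [[C Cop <-] Cx sCB]].
  have /nbhs_ballP[d /= d0 dC] : nbhs (x k) C by apply: open_nbhs_nbhs.
  exists d => // y xy; apply: sCB; exact: dC.
apply: (@filterS _ (nbhs x) _ (box d)) => //.
apply: (@filter_forall _ _ (fun k (y : {ptws 'I_n -> T}) => ball (x k) d (y k))
  (nbhs x)) => k.
exact: (@proj_continuous _ (fun _ : 'I_n => T) k x _ (nbhsx_ballx (x k) d d0)).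
Qed.

Section Ultralimit.
Context (R : realType) (I : Type) (U : set_system I) (UU : UltraFilter U).
Hypothesis Ucc : countably_complete U.

Lemma cc_union (A : nat -> set I) : (forall i, exists n, A n i) ->
  exists n, U (A n).
Proof.
move=> AI; apply: contrapT => /forallNP nA.
have : U (\bigcap_n ~` A n).
  by apply: Ucc => n; have [/nA|] := in_ultra_setVsetC (A n) UU.
move=> /filter_ex[i Ai]; have [n Ani] := AI i.
exact: (Ai n).
Qed.

Lemma ultra_const (h : I -> R) : exists r, U [set i | h i = r].
Proof.
pose S := [set q | U [set i | q <= h i]].
have [n0 Un0] : exists n, U [set i | `|h i| <= n%:R].
  by apply: cc_union => i; exists (Num.truncn `|h i|).+1; exact: ltW (truncnS_gt _).
have Sn0 : has_sup S.
  split.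
    exists (- n0%:R); apply: filterS Un0 => i /=.
    by rewrite ler_norml => /andP[].
  exists n0%:R => q Sq.
  have /filter_ex[i [/= qi]] :
      U ([set i | q <= h i] `&` [set i | `|h i| <= n0%:R]) by exact: filterI.
  by rewrite ler_norml => /andP[_]; exact: le_trans.
exists (sup S).
have lo n : U [set i | sup S - n.+1%:R^-1 <= h i].
  have [|q Sq lq] := @sup_adherent _ S n.+1%:R^-1 _ Sn0.
    by rewrite invr_gt0.
  by apply: filterS Sq => i /=; apply: le_trans; exact: ltW.
have hi n : U [set i | h i <= sup S + n.+1%:R^-1].
  set A := [set i | _]; have [//|UnA] := in_ultra_setVsetC A UU.
  suff /(sup_upper_bound Sn0) : S (sup S + n.+1%:R^-1).
    by rewrite gerDl leNgt invr_gt0 ltr0n.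
  by apply: filterS UnA => i /= /negP; rewrite -ltNge => /ltW.
apply: filterS (filterI (Ucc lo) (Ucc hi) : U _) => i [/= Hlo Hhi].
apply/eqP; rewrite eq_le; apply/andP; split; apply/ler_addgt0Pr => e e0;
  have [n ne] : exists n, n.+1%:R^-1 < e by
    exists (Num.truncn e^-1);
      rewrite invf_plt ?posrE//; exact: truncnS_gt.
- by apply: le_trans (Hhi n Logic.I) _; rewrite lerD2l ltW.
- move: (Hlo n Logic.I) => /=; rewrite lerBlDr => /le_trans; apply.
  by rewrite lerD2l ltW.
Qed.

Definition ulim (h : I -> R) : R := lim (h @ U).

Lemma ulim_eq (h : I -> R) (r : R) : U [set i | h i = r] -> ulim h = r.
Proof.
move=> hr; apply: cvg_lim => //; apply: cvg_near_cst; exact: hr.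
Qed.

Lemma ulimE (h : I -> R) : U [set i | h i = ulim h].
Proof. by have [r hr] := ultra_const h; rewrite (ulim_eq hr). Qed.

End Ultralimit.

Section UltraproductSpace.
Context (R : realType) (I : Type) (U : set_system I) (UU : UltraFilter U).
Context (Ucc : countably_complete U) (M : I -> completeMetricType R).
Implicit Types x y z : forall i, M i.

Definition udist x y : R := ulim U (fun i => mdist (x i) (y i)).

Lemma udistE x y : U [set i | mdist (x i) (y i) = udist x y].
Proof. exact: ulimE. Qed.

Lemma udist_eq0 x y : udist x y = 0 <-> U [set i | x i = y i].
Proof.
split=> [xy0|xy].
  apply: filterS (udistE x y) => i /=; rewrite xy0; exact: mdist_positivity.
by apply: ulim_eq; apply: filterS xy => i /= ->; exact: mdistxx.
Qed.

Lemma udistxx x : udist x x = 0.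
Proof. by apply/udist_eq0; apply: filterS filterT. Qed.

Lemma udist_sym x y : udist x y = udist y x.
Proof.
by apply: ulim_eq; apply: filterS (udistE y x) => i /= <-; exact: metric_sym.
Qed.

Lemma udist_triangle y x z : udist x z <= udist x y + udist y z.
Proof.
have /filter_ex[i [/= <- [<- <-]]] :
  U ([set i | mdist (x i) (z i) = udist x z] `&`
    ([set i | mdist (x i) (y i) = udist x y] `&`
     [set i | mdist (y i) (z i) = udist y z])).
  by apply: filterI; [|apply: filterI]; exact: udistE.
exact: metric_triangle.
Qed.

Definition uequiv x y : bool := udist x y == 0.

Lemma uequivP x y : reflect (U [set i | x i = y i]) (uequiv x y).
Proof. by apply: (iffP eqP) => /udist_eq0. Qed.

Lemma uequiv_refl : reflexive uequiv.
Proof. by move=> x; apply/eqP; exact: udistxx. Qed.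

Lemma uequiv_sym : symmetric uequiv.
Proof. by move=> x y; rewrite /uequiv udist_sym. Qed.

Lemma uequiv_trans : transitive uequiv.
Proof.
move=> y x z /uequivP xy /uequivP yz; apply/uequivP.
by apply: filterS2 xy yz => i /= -> ->.
Qed.

Definition uequiv_rel := EquivRel uequiv uequiv_refl uequiv_sym uequiv_trans.
Canonical uequiv_rel.

Definition ultraproduct_space := {eq_quot uequiv_rel}.

HB.instance Definition _ := EqQuotient.on ultraproduct_space.
HB.instance Definition _ := Choice.on ultraproduct_space.

Definition upi x : ultraproduct_space := \pi_ultraproduct_space x.

Lemma upi_eq x y : upi x = upi y <-> U [set i | x i = y i].
Proof.
split=> [/eqP|xy]; first by rewrite eqmodE => /uequivP.
by apply/eqP; rewrite eqmodE; apply/uequivP.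
Qed.

Lemma upi_repr (a : ultraproduct_space) : upi (repr a) = a.
Proof. exact: reprK. Qed.

Lemma repr_upi x : U [set i | repr (upi x) i = x i].
Proof. by apply/upi_eq; rewrite upi_repr. Qed.

Definition uspace_dist (a b : ultraproduct_space) : R := udist (repr a) (repr b).

Lemma uspace_distE x y : uspace_dist (upi x) (upi y) = udist x y.
Proof.
apply: ulim_eq; apply: filterS3 (repr_upi x) (repr_upi y) (udistE x y).
by move=> i /= -> ->.
Qed.

Let uspace_distxx a : uspace_dist a a = 0. Proof. exact: udistxx. Qed.

Let uspace_dist_positivity a b : uspace_dist a b = 0 -> a = b.
Proof. by rewrite -[a]upi_repr -[b]upi_repr uspace_distE => /udist_eq0/upi_eq. Qed.

Let uspace_dist_sym a b : uspace_dist a b = uspace_dist b a.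
Proof. exact: udist_sym. Qed.

Let uspace_dist_triangle b a c :
  uspace_dist a c <= uspace_dist a b + uspace_dist b c.
Proof. exact: udist_triangle. Qed.

HB.instance Definition _ := isMetric.Build R ultraproduct_space
  uspace_distxx uspace_dist_positivity uspace_dist_sym uspace_dist_triangle.

HB.instance Definition _ := isPointed.Build ultraproduct_space (upi (fun=> point)).

Lemma mdist_upi x y : mdist (upi x) (upi y) = udist x y.
Proof. exact: uspace_distE. Qed.

Lemma mdist_upiE x y : U [set i | mdist (x i) (y i) = mdist (upi x) (upi y)].
Proof. by rewrite mdist_upi; exact: udistE. Qed.

Let ultraproduct_complete (F : set_system ultraproduct_space) :
  ProperFilter F -> cauchy F -> cvg F.
Proof.
move=> FF /cauchyP Fc.
pose e n : R := n.+1%:R^-1.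
have e0 n : 0 < e n by rewrite invr_gt0.
have /choice[p Fp] n : exists x, F (ball (upi x) (e n)).
  by have [a Fa] := Fc _ (e0 n); exists (repr a); rewrite upi_repr.
have dp n m : mdist (upi (p n)) (upi (p m)) < e n + e m.
  have /filter_ex[a] : F (ball (upi (p n)) (e n) `&` ball (upi (p m)) (e m)).
    exact: filterI.
  rewrite !ballEmdist => -[/= na ma].
  by rewrite (le_lt_trans (metric_triangle _ a _))// ltrD// metric_sym.
pose A := [set i | forall n m, mdist (p n i) (p m i) < e n + e m].
have UA : U A.
  have : U (\bigcap_n \bigcap_m [set i | mdist (p n i) (p m i) < e n + e m]).
    apply: Ucc => n; apply: Ucc => m; apply: filterS (mdist_upiE (p n) (p m)).
    by move=> i /= ->.
  by apply: filterS => i Ai n m; exact: Ai.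
have elt (d : R) : 0 < d -> exists N, forall n, (N <= n)%N -> e n < d.
  move=> d0; exists (Num.truncn d^-1) => n Nn.
  rewrite invf_plt ?posrE// (lt_le_trans (truncnS_gt _))// ler_nat ltnS//.
pose q i := lim ((p ^~ i) @ \oo).
have dq i n : A i -> mdist (p n i) (q i) <= e n.
  move=> Ai.
  have /cauchy_cvg cq : cauchy ((p ^~ i) @ \oo).
    apply/cauchy_exP => d d0; have [N Nd] := elt (d / 2) (divr_gt0 d0 (ltr0Sn _ 1)).
    exists (p N i), N => // m Nm /=; rewrite ballEmdist /=.
    by rewrite (lt_trans (Ai N m))// [d]splitr ltrD// Nd.
  apply/ler_addgt0Pr => d d0.
  have /cq[N1 _ qN1] : nbhs (q i) (ball (q i) (d / 2)).
    by apply: nbhsx_ballx; rewrite divr_gt0.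
  have [N2 N2d] := elt (d / 2) (divr_gt0 d0 (ltr0Sn _ 1)).
  pose N := maxn N1 N2.
  have := qN1 N (leq_maxl _ _); rewrite /= ballEmdist /= => qN.
  apply: le_trans (metric_triangle _ (p N i) _) _.
  rewrite [d]splitr addrA lerD ?ltW//; last by rewrite metric_sym.
  by rewrite (lt_le_trans (Ai n N))// lerD2l ltW// N2d// leq_maxr.
have dpq n : mdist (upi (p n)) (upi q) <= e n.
  have /filter_ex[i [/= Ai <-]] : U (A `&`
    [set i | mdist (p n i) (q i) = mdist (upi (p n)) (upi q)]).
    by apply: filterI => //; exact: mdist_upiE.
  exact: dq.
apply/cvg_ex; exists (upi q) => B /nbhs_ballP[d /= d0 dB].
have [n /(_ n (leqnn n)) nd] := elt (d / 2) (divr_gt0 d0 (ltr0Sn _ 1)).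
apply: filterS (Fp n) => a; rewrite ballEmdist /= => pa; apply: dB.
rewrite ballEmdist /=; apply: le_lt_trans (metric_triangle _ (upi (p n)) _) _.
by rewrite [d]splitr ltrD// ?(lt_trans pa)// metric_sym (le_lt_trans (dpq n)).
Qed.

HB.instance Definition _ :=
  Uniform_isComplete.Build ultraproduct_space ultraproduct_complete.

End UltraproductSpace.

Section MetricUltraproduct.
Context (R : realType) (L : language).
Context (I : Type) (U : set_system I) (UU : UltraFilter U).
Context (Ucc : countably_complete U) (M : I -> structure R L).

Local Notation "'PU'" := (ultraproduct_space UU Ucc M).

Definition uprod_fint (s : fsym L) (a : {ptws 'I_(farity s) -> PU}) : PU :=
  upi UU Ucc (fun i => fint (M i) (fun k => repr (a k) i)).

Definition uprod_pint (p : psym L) (a : {ptws 'I_(parity p) -> PU}) : R :=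
  ulim U (fun i => pint (M i) (fun k => repr (a k) i)).

Lemma repr_tuple (n : nat) (x : 'I_n -> forall i, M i) :
  U [set i | (fun k => repr (upi UU Ucc (x k)) i) = (fun k => x k i)].
Proof.
have : U [set i | forall k, repr (upi UU Ucc (x k)) i = x k i].
  by apply: (@filter_forall _ _ (fun k i => repr (upi UU Ucc (x k)) i = x k i))
    => k; exact: repr_upi.
by apply: filterS => i xi; apply/funext.
Qed.

(* The interpretations do not depend on the choice of representatives. *)
Lemma uprod_fintE (s : fsym L) (x : 'I_(farity s) -> forall i, M i) :
  uprod_fint (fun k => upi UU Ucc (x k)) =
  upi UU Ucc (fun i => fint (M i) (fun k => x k i)).
Proof. by apply/upi_eq; apply: filterS (repr_tuple x) => i /= ->. Qed.

Lemma uprod_pintE (p : psym L) (x : 'I_(parity p) -> forall i, M i) :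
  uprod_pint (fun k => upi UU Ucc (x k)) =
  ulim U (fun i => pint (M i) (fun k => x k i)).
Proof.
apply: ulim_eq; apply: filterS2 (repr_tuple x) (ulimE UU Ucc _).
by move=> i /= ->; exact.
Qed.

Lemma near_tuple (n : nat) (a : {ptws 'I_n -> PU})
    (P : forall i, set {ptws 'I_n -> M i}) :
  (forall i, nbhs ((fun k => repr (a k) i) : {ptws 'I_n -> M i}) (P i)) ->
  \forall b \near a, U [set i | P i (fun k => repr (b k) i)].
Proof.
move=> aP; have [N UN] : exists N, U [set i | forall y : {ptws 'I_n -> M i},
    (forall k, ball (repr (a k) i) N.+1%:R^-1 (y k)) -> P i y].
  apply: cc_union => // i; have /nbhs_ptwsP[d d0 dP] := aP i.
  exists (Num.truncn d^-1) => y ay; apply: dP => k; apply: le_ball (ay k).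
  by rewrite invf_ple ?posrE// ltW// truncnS_gt.
apply/nbhs_ptwsP; exists N.+1%:R^-1; first by rewrite invr_gt0.
move=> b ab; have ab' k : U [set i | ball (repr (a k) i) N.+1%:R^-1 (repr (b k) i)].
  apply: filterS (mdist_upiE UU Ucc (repr (a k)) (repr (b k))) => i /= abi.
  by have := ab k; rewrite !ballEmdist /= abi !upi_repr.
have : U [set i | forall k, ball (repr (a k) i) N.+1%:R^-1 (repr (b k) i)].
  exact: (@filter_forall _ _
    (fun k i => ball (repr (a k) i) N.+1%:R^-1 (repr (b k) i))).
by move=> H; apply: filterS2 UN H => i /= + H; exact.
Qed.

Lemma mdist_upi_lt (x y : forall i, M i) (d : R) :
  U [set i | ball (x i) d (y i)] -> mdist (upi UU Ucc x) (upi UU Ucc y) < d.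
Proof.
move=> xyd; 
have /filter_ex[i [/= xyi <-]] : U ([set i | ball (x i) d (y i)] `&`
    [set i | mdist (x i) (y i) = mdist (upi UU Ucc x) (upi UU Ucc y)]).
  by apply: filterI => //; exact: mdist_upiE.
by move: xyi; rewrite ballEmdist.
Qed.

Lemma uprod_fint_continuous (s : fsym L) : continuous (@uprod_fint s).
Proof.
move=> a B /nbhs_ballP[d /= d0 dB].
have : \forall b \near a, U [set i | ball (fint (M i) (fun k => repr (a k) i)) d
    (fint (M i) (fun k => repr (b k) i))].
  apply: (@near_tuple _ a (fun i => [set y |
    ball (fint (M i) (fun k => repr (a k) i)) d (fint (M i) y)])) => i.
  exact: (@fint_continuous _ _ _ (M i) s _ _ (nbhsx_ballx _ _ d0)).
apply: (@filterS _ (nbhs a) (nbhs_filter a) _ (@uprod_fint _ @^-1` B)) => b Ub.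
apply: (dB (uprod_fint b)).
rewrite ballEmdist; exact: mdist_upi_lt Ub.
Qed.

Lemma uprod_pint_continuous (p : psym L) : continuous (@uprod_pint p).
Proof.
move=> a B /nbhs_ballP[d /= d0 dB].
have : \forall b \near a, U [set i | ball (pint (M i) (fun k => repr (a k) i)) d
    (pint (M i) (fun k => repr (b k) i))].
  apply: (@near_tuple _ a (fun i => [set y |
    ball (pint (M i) (fun k => repr (a k) i)) d (pint (M i) y)])) => i.
  exact: (@pint_continuous _ _ _ (M i) p _ _ (nbhsx_ballx _ _ d0)).
apply: (@filterS _ (nbhs a) (nbhs_filter a) _ (@uprod_pint _ @^-1` B)) => b Ub.
apply: (dB (uprod_pint b)).
have /filter_ex[i [/= abi [ai bi]]] :
    U ([set i | ball (pint (M i) (fun k => repr (a k) i)) d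
                  (pint (M i) (fun k => repr (b k) i))] `&`
      ([set i | pint (M i) (fun k => repr (a k) i) = uprod_pint a] `&`
       [set i | pint (M i) (fun k => repr (b k) i) = uprod_pint b])).
  by apply: filterI => //; apply: filterI; exact: ulimE.
by move: abi; rewrite ai bi.
Qed.

Definition metric_ultraproduct : structure R L :=
  @Structure R L PU (Interpretation uprod_fint_continuous uprod_pint_continuous).

End MetricUltraproduct.

(* Main.v *)
(* Work with the sets underlying strong substructures.  By downward
   Lowenheim-Skolem, recursion on the size of F yields, in every M_i, a monotone
   family of strong substructures X_{i,F} of density at most kappa, indexed by
   the finite subsets F of the ultraproduct, with X_{i,F} containing the i-th
   coordinates of the points of F.  Enumerate a dense subset of each X_{i,F} by
   kappa * nat.  Real-valued functions on I are constant on a set of U, and U is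
   closed under kappa-indexed intersections; hence for U-almost all i the
   enumeration of X_{i,F} has the same distances, function values and predicate
   values as its class in the ultraproduct, so that X_{i,F} is isomorphic to the
   closure Y_F of that class, and for F included in G the inclusion of X_{i,F}
   in X_{i,G} is carried to that of Y_F in Y_G.  The Y_F thus form a directed
   system of strong substructures covering the ultraproduct, and a MAEC is closed
   under such unions: well-order the index points, and prove by transfinite
   induction on an initial segment D that the union of the Y_G over finite G
   included in D together with a fixed finite set F lies in K, strongly and
   monotonically in D and F. *)
From HB Require Import structures.
From mathcomp Require Import all_boot all_order all_algebra.
From mathcomp Require Import finmap.
From mathcomp Require Import all_classical all_reals.
From mathcomp Require Import topology function_spaces normedtype.
From mathcomp Require Import lra.
From mathcomp Require wochoice.
Require Import Defs.

Set Implicit Arguments.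
Unset Strict Implicit.
Unset Printing Implicit Defensive.

Import Order.TTheory GRing.Theory Num.Theory.
Import numFieldNormedType.Exports.

Local Open Scope classical_set_scope.
Local Open Scope card_scope.
Local Open Scope ring_scope.

(** * Closures, isometries and continuity in metric spaces *)

Section MetricSpaces.
Context (R : realType).

Lemma closure_mdistP (T : metricType R) (A : set T) (x : T) :
  closure A x <-> forall e : R, 0 < e -> exists2 a, A a & mdist x a < e.
Proof.
split=> [clA e e0|Ae B /nbhs_ballP[e /= e0 eB]].
  have [a [Aa]] := clA _ (nbhsx_ballx x e e0).
  by rewrite ballEmdist => xa; exists a.
have [a Aa xa] := Ae _ e0.
by exists a; split => //; apply: eB; rewrite ballEmdist.
Qed.

Lemma mdist_small_eq (T : metricType R) (x y : T) :
  (forall e : R, 0 < e -> mdist x y < e) -> x = y.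
Proof.
move=> xye; apply: mdist_positivity; apply/eqP; rewrite eq_le mdist_ge0 andbT.
by apply/ler_addgt0Pr => e e0; rewrite add0r ltW// xye.
Qed.

Lemma isometry_inj (T T' : metricType R) (f : T -> T') :
  isometry f -> injective f.
Proof. by move=> fi x y fxy; apply: mdist_positivity; rewrite -fi fxy mdistxx. Qed.

(** The points sent near a limit point [y] generate a Cauchy filter on the complete space [T], and
    its limit is sent to [y]. *)
Lemma isometry_closed_range (T : completeMetricType R) (T' : metricType R)
  (f : T -> T') : isometry f -> closed (range f).
Proof.
move=> fi y /closure_mdistP cly.
pose F := filter_from [set e : R | 0 < e] (fun e => [set x | mdist y (f x) < e]).
have FF : ProperFilter F.
  apply: filter_from_proper; last first.
    by move=> e /= /cly[_ [x _ <-] yx]; exists x.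
  apply: filter_from_filter; first by exists 1 => /=.
  move=> d e d0 e0; exists (Num.min d e); first by rewrite /= lt_min d0.
  by move=> x /=; rewrite lt_min => /andP[].
have /cauchy_cvg/cvg_ex[x Fx] : cauchy F.
  apply/cauchyP => e e0; have e20 : 0 < e / 2 by rewrite divr_gt0.
  have [_ [x _ <-] yx] := cly _ e20; exists x; exists (e / 2) => // z /= yz.
  rewrite ballEmdist /= -fi (le_lt_trans (metric_triangle _ y _))//.
  by rewrite [e]splitr ltrD// metric_sym.
exists x => //; apply: mdist_small_eq => e e0.
have e20 : 0 < e / 2 by rewrite divr_gt0.
have /filter_ex[z []] : F (ball x (e / 2) `&` [set z | mdist y (f z) < e / 2]).
  apply: filterI; first exact/Fx/nbhsx_ballx.
  by exists (e / 2).
rewrite ballEmdist /= => xz yz.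
rewrite (le_lt_trans (metric_triangle _ (f z) _))// fi.
by rewrite [e]splitr ltrD// metric_sym.
Qed.

(** The arity is finite, so every pointwise neighbourhood contains a box and tuples from [D] are
    dense; no uniform continuity is involved. *)
Lemma eq_continuous_tuples (T T' : metricType R) (n : nat) (D : set T)
    (f g : {ptws 'I_n -> T} -> T') :
  closure D = setT -> continuous f -> continuous g ->
  (forall x : 'I_n -> T, (forall k, D (x k)) -> f x = g x) -> f = g.
Proof.
move=> clD fc gc fgD; apply/funext => x; apply: mdist_small_eq => e e0.
have e20 : 0 < e / 2 by rewrite divr_gt0.
have /nbhs_ptwsP[d d0 dfg] : nbhs x
    ((f @^-1` ball (f x) (e / 2)) `&` (g @^-1` ball (g x) (e / 2))).
  by apply: filterI; [apply: fc|apply: gc]; exact: nbhsx_ballx.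
have /choice[z zP] k : exists z, D z /\ ball (x k) d z.
  have /closure_mdistP/(_ _ d0)[z Dz xz] : closure D (x k) by rewrite clD.
  by exists z; rewrite ballEmdist.
have [] := dfg z (fun k => (zP k).2); rewrite /= !ballEmdist /= => fz gz.
rewrite (le_lt_trans (metric_triangle _ (f z) _))//.
by rewrite [e]splitr ltrD// fgD 1?metric_sym// => k; case: (zP k).
Qed.

Lemma isometry_tuple_continuous (T T' : metricType R) (n : nat) (h : T -> T') :
  isometry h ->
  continuous ((fun x k => h (x k)) : {ptws 'I_n -> T} -> {ptws 'I_n -> T'}).
Proof.
move=> hi x B /nbhs_ptwsP[d d0 dB]; apply/nbhs_ptwsP; exists d => // y xy.
by apply: dB => k; have := xy k; rewrite !ballEmdist /= hi.
Qed.

Lemma isometry_continuous (T T' : metricType R) (h : T -> T') :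
  isometry h -> continuous h.
Proof.
move=> hi x B /nbhs_ballP[d /= d0 dB]; apply/nbhs_ballP; exists d => // y.
by rewrite /= ballEmdist /= -hi => hxy; apply: dB; rewrite ballEmdist.
Qed.

End MetricSpaces.

(** * Closed subsets as complete metric spaces *)

Section ClosedSubspace.
Context (R : realType) (T : completeMetricType R) (Y : set T).
Context (x0 : T) (Yx0 : Y x0) (Y_closed : closed Y).

(* The proofs are arguments so that the instances below can depend on them. *)
Definition closed_subspace of Y x0 & closed Y : Type := {x : T | x \in Y}.
Local Notation S := (closed_subspace Yx0 Y_closed).

HB.instance Definition _ := Choice.on S.

Definition subspace_incl (x : S) : T := val x.

Definition to_subspace (x : T) (Yx : Y x) : S := exist _ x (mem_set Yx).

Lemma subspace_inclP (x : S) : Y (subspace_incl x).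
Proof. exact: set_mem (valP x). Qed.

Let dist (x y : S) : R := mdist (subspace_incl x) (subspace_incl y).

Let distxx x : dist x x = 0. Proof. exact: mdistxx. Qed.
Let dist_positivity x y : dist x y = 0 -> x = y.
Proof. by move/mdist_positivity/val_inj. Qed.
Let dist_sym x y : dist x y = dist y x. Proof. exact: metric_sym. Qed.
Let dist_triangle y x z : dist x z <= dist x y + dist y z.
Proof. exact: metric_triangle. Qed.

HB.instance Definition _ :=
  isMetric.Build R S distxx dist_positivity dist_sym dist_triangle.
HB.instance Definition _ := isPointed.Build S (to_subspace Yx0).

Let subspace_complete (F : set_system S) : ProperFilter F -> cauchy F -> cvg F.
Proof.
move=> FF /cauchyP Fc.
have /cauchy_cvg/cvg_ex[x Fx] : cauchy (subspace_incl @ F).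
  apply/cauchyP => e e0; have [a Fa] := Fc _ e0; exists (subspace_incl a).
  apply: (@filterS _ F _ (ball a e)) Fa => b; rewrite /preimage /= !ballEmdist.
  exact.
have Yx : Y x.
  apply: Y_closed => B /Fx FB; have [a Ba] := @filter_ex _ F _ _ FB.
  by exists (subspace_incl a); split => //; exact: subspace_inclP.
apply/cvg_ex; exists (to_subspace Yx) => B /nbhs_ballP[e /= e0 eB].
apply: (@filterS _ F _ (subspace_incl @^-1` ball x e)); last first.
  exact/Fx/nbhsx_ballx.
by move=> a; rewrite /preimage /= ballEmdist => xa; apply: eB; rewrite ballEmdist.
Qed.

HB.instance Definition _ := Uniform_isComplete.Build S subspace_complete.

End ClosedSubspace.

(** * Embeddings of structures *)

Section Embeddings.
Context (R : realType) (L : language).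
Implicit Types M N Q : structure R L.

Lemma embedding_inj M N (f : M -> N) : embedding f -> injective f.
Proof. by move=> /embedding_isometry/isometry_inj. Qed.

(** Both sides of each identity are continuous in the tuple, so the test on a dense set decides. *)
Lemma embedding_dense N Q (D : set N) (h : N -> Q) :
  isometry h -> closure D = setT ->
  (forall s (x : 'I_(farity s) -> N), (forall k, D (x k)) ->
    h (fint N x) = fint Q (h \o x)) ->
  (forall p (x : 'I_(parity p) -> N), (forall k, D (x k)) ->
    pint Q (h \o x) = pint N x) ->
  embedding h.
Proof.
move=> hi clD hf hp; split=> // [s|p].
- suff : (fun x : {ptws 'I_(farity s) -> N} => h (fint N x)) =
         (fun x : {ptws 'I_(farity s) -> N} => fint Q (h \o x)).
    by move=> /(congr1 (fun u => u _)) + x => /(_ x).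
  apply: (eq_continuous_tuples clD) => [x|x|]; last exact: hf.
    apply: continuous_comp; first exact: fint_continuous.
    exact: isometry_continuous hi _.
  apply: (@continuous_comp _ _ _ _ (@fint _ _ _ Q s)).
    exact: isometry_tuple_continuous hi _.
  exact: fint_continuous.
- suff : (fun x : {ptws 'I_(parity p) -> N} => pint Q (h \o x) : R^o) =
         (fun x : {ptws 'I_(parity p) -> N} => pint N x).
    by move=> /(congr1 (fun u => u _)) + x => /(_ x).
  apply: (eq_continuous_tuples clD) => [x|x|]; last exact: hp.
    apply: (@continuous_comp _ _ _ _ (@pint _ _ _ Q p)).
      exact: isometry_tuple_continuous hi _.
    exact: pint_continuous.
  exact: pint_continuous.
Qed.

Lemma embedding_lift N N' Q (f : N -> Q) (g : N' -> Q) :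
  embedding f -> embedding g -> range f `<=` range g ->
  exists2 e : N -> N', embedding e & forall x, g (e x) = f x.
Proof.
move=> fE gE fg.
have /choice[e eP] x : exists y, g y = f x.
  by have [|y _ <-] := fg (f x); [exists x|exists y].
exists e => //; split=> [x y|s x|p x].
- by rewrite -(embedding_isometry gE) !eP (embedding_isometry fE).
- apply: (embedding_inj gE); rewrite eP (embedding_fint fE) (embedding_fint gE).
  by congr fint; apply/funext => k /=; rewrite eP.
- rewrite -(embedding_pint fE) -(embedding_pint gE).
  by congr pint; apply/funext => k /=; rewrite eP.
Qed.

Lemma embedding_surj_iso N N' (e : N -> N') :
  embedding e -> (forall y, exists x, e x = y) -> isomorphism e.
Proof.
move=> eE /choice[g gK]; split=> //; exists g => // x.
by apply: (embedding_inj eE); rewrite gK.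
Qed.

Lemma embedding_lift_iso N N' Q (f : N -> Q) (g : N' -> Q) :
  embedding f -> embedding g -> range f = range g ->
  exists2 e : N -> N', isomorphism e & forall x, g (e x) = f x.
Proof.
move=> fE gE fg; have [|e eE eP] := embedding_lift fE gE; first by rewrite fg.
exists e => //; apply: embedding_surj_iso => // y.
have [x _ fx] : range f (g y) by rewrite fg; exists y.
by exists x; apply: (embedding_inj gE); rewrite eP.
Qed.

End Embeddings.

(** * Strong substructures as subsets *)

(* Since the class is closed under isomorphism, the strong substructures of an
   ambient structure Q (which need not belong to K) are identified with their
   underlying sets. *)
Section StrongSubsets.
Context (R : realType) (L : language) (K : structure_class R L).
Hypothesis K_MAEC : is_MAEC K.
Implicit Types (M N Q : structure R L).

Definition represents N Q (f : N -> Q) (X : set Q) : Prop :=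
  [/\ K N, embedding f & range f = X].

Definition Kset Q (X : set Q) : Prop :=
  exists (N : structure R L) (f : N -> Q), represents f X.

Definition strong_sub Q (X Y : set Q) : Prop :=
  exists (N N' : structure R L) (f : N -> Q) (f' : N' -> Q) (h : N -> N'),
    [/\ represents f X, represents f' Y, strong K h & forall x, f' (h x) = f x].

(** [strong_sub] only provides some representatives. Any two representatives of one set are
    isomorphic over [Q], so closure under isomorphism moves the strong map to the prescribed
    ones. *)
Lemma represents_strong N N' Q (X Y : set Q) (f : N -> Q) (f' : N' -> Q) :
  represents f X -> represents f' Y -> strong_sub X Y ->
  exists2 h : N -> N', strong K h & forall x, f' (h x) = f x.
Proof.
move=> [KN fE fX] [KN' f'E f'Y] [M [M' [g [g' [h [[KM gE gX] [KM' g'E g'Y] hs hP]]]]]].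
have [|u uI uP] := embedding_lift_iso gE fE; first by rewrite gX fX.
have [|v vI vP] := embedding_lift_iso g'E f'E; first by rewrite g'Y f'Y.
have [_ [w uK wK]] := uI.
exists (v \o h \o w) => [|x].
  by apply: (strong_iso K_MAEC uI vI _ hs) => x /=; rewrite uK.
by rewrite /= vP hP -uP wK.
Qed.

Lemma strong_sub_Kset Q (X Y : set Q) : strong_sub X Y -> Kset X /\ Kset Y.
Proof.
by move=> [M [M' [g [g' [h [gX gY _ _]]]]]]; split; [exists M, g|exists M', g'].
Qed.

Lemma strong_sub_refl Q (X : set Q) : Kset X -> strong_sub X X.
Proof.
move=> [N [f fX]]; exists N, N, f, f, id; split=> //.
by apply: (strong_refl K_MAEC); case: fX.
Qed.

Lemma strong_sub_trans Q (X Y Z : set Q) :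
  strong_sub X Y -> strong_sub Y Z -> strong_sub X Z.
Proof.
move=> XY YZ; have [[N [f fX]] [N' [f' fY]]] := strong_sub_Kset XY.
have [_ [N'' [f'' fZ]]] := strong_sub_Kset YZ.
have [h hs hP] := represents_strong fX fY XY.
have [k ks kP] := represents_strong fY fZ YZ.
exists N, N'', f, f'', (k \o h); split=> // [|x]; last by rewrite /= kP hP.
exact: strong_trans hs ks.
Qed.

Lemma strong_sub_subset Q (X Y : set Q) : strong_sub X Y -> X `<=` Y.
Proof.
move=> [N [N' [f [f' [h [[_ _ <-] [_ _ <-] _ hP]]]]]] _ [x _ <-].
by exists (h x).
Qed.

Lemma Kset_closed Q (X : set Q) : Kset X -> closed X.
Proof.
by move=> [N [f [_ fE <-]]]; exact/isometry_closed_range/embedding_isometry.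
Qed.

Lemma strong_sub_coherence Q (X Y Z : set Q) :
  strong_sub X Z -> strong_sub Y Z -> X `<=` Y -> strong_sub X Y.
Proof.
move=> XZ YZ XY; have [[N [f fX]] [N'' [f'' fZ]]] := strong_sub_Kset XZ.
have [[N' [f' fY]] _] := strong_sub_Kset YZ.
have [h hs hP] := represents_strong fX fZ XZ.
have [k ks kP] := represents_strong fY fZ YZ.
have [KN fE fX'] := fX; have [KN' f'E fY'] := fY; have [_ f''E _] := fZ.
have [|e eE eP] := embedding_lift fE f'E; first by rewrite fX' fY'.
exists N, N', f, f', e; split=> //.
apply: (coherence K_MAEC eE ks); suff -> : k \o e = h by [].
by apply/funext => x; apply: (embedding_inj f''E); rewrite /= kP eP hP.
Qed.

Lemma Kset_member Q : Kset [set: Q] -> K Q.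
Proof.
move=> [N [f [KN fE fT]]]; apply: (member_iso K_MAEC _ KN (g := f)).
apply: embedding_surj_iso => // y.
by have [x] : range f y; [rewrite fT|exists x].
Qed.

Lemma strong_sub_range N M (f : N -> M) :
  K N -> K M -> strong K f -> strong_sub (range f) [set: M].
Proof.
move=> KN KM fs; exists N, M, f, id, f; split=> //.
  by split=> //; exact: strong_embedding fs.
by split=> //; rewrite image_id.
Qed.

(** * Unions of well-ordered chains of subsets *)

Section Chain.
Context (Q : structure R L) (J : Type) (le : rel J) (X : J -> set Q).
Hypothesis J_inhabited : inhabited J.
Hypothesis le_wo : wochoice.well_order le.
Hypothesis le_refl : forall j, le j j.
Hypothesis le_total : forall i j, le i j \/ le j i.
Hypothesis X_strong : forall i j, le i j -> strong_sub (X i) (X j).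

Let Y := closure (\bigcup_j X j).

(** The chain axiom puts a structure on the closed subspace [Y] without reference to [Q]; that its
    symbols agree with those of [Q] is checked on the dense union. *)
Lemma strong_chain :
  [/\ Kset Y, forall j, strong_sub (X j) Y &
      forall Z, (forall j, strong_sub (X j) Z) -> strong_sub Y Z].
Proof.
have XK j : Kset (X j) by have [] := strong_sub_Kset (X_strong (le_refl j)).
have [N [f fX]] : exists (N : J -> structure R L) (f : forall j, N j -> Q),
    forall j, represents (f j) (X j).
  exists (fun j => projT1 (cid (XK j))).
  exists (fun j => projT1 (cid (projT2 (cid (XK j))))) => j.
  exact: projT2 (cid (projT2 (cid (XK j)))).
have fE j : embedding (f j) by have [] := fX j.
have eS i j (ij : le i j) : {h : N i -> N j | strong K h /\ forall x, f j (h x) = f i x}.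
  apply: cid; have [h hs hP] := represents_strong (fX i) (fX j) (X_strong ij).
  by exists h.
pose e i j ij := sval (eS i j ij).
have eP i j ij x : f j (@e i j ij x) = f i x by exact: (svalP (eS i j ij)).2.
have eK i j ij : strong K (@e i j ij) by have [] := svalP (eS i j ij).
have Ncl : increasing_chain K e.
  split=> // [j|i ii x|i j k ij jk ik x]; first by have [] := fX j.
    by apply: (embedding_inj (fE i)).
  by apply: (embedding_inj (fE k)); rewrite !eP.
have [j0] := J_inhabited.
have Yf j x : Y (f j x).
  by apply: subset_closure; exists j => //; have [_ _ <-] := fX j; exists x.
have Ycl : closed Y by exact: closed_closure.
pose T : completeMetricType R := closed_subspace (Yf j0 point) Ycl.
pose c j (x : N j) : T := to_subspace (Yf j0 point) Ycl (Yf j x).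
pose incl : T -> Q := @subspace_incl R Q Y _ (Yf j0 point) Ycl.
have incl_iso : isometry incl by [].
have incl_c j x : incl (c j x) = f j x by [].
have Tden (t : T) (d : R) : 0 < d -> exists j x, mdist t (c j x) < d.
  move=> d0; have /closure_mdistP/(_ _ d0)[q [j _ Xq] tq] : Y (incl t).
    exact: subspace_inclP.
  by move: Xq tq; have [_ _ <-] := fX j => -[x _ <-] tx; exists j, x.
have clT : closure (\bigcup_j range (c j)) = [set: T].
  apply/seteqP; split=> // t _; apply/closure_mdistP => d /(Tden t)[j [x tx]].
  by exists (c j x) => //; exists j => //; exists x.
have Tcompl : chain_completion e c.
  split=> [i j ij x|j x y|].
  - by apply: (isometry_inj incl_iso); rewrite !incl_c eP.
  - by rewrite -incl_iso !incl_c (embedding_isometry (fE j)).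
  - move=> O [t Ot] Oop; have : closure (\bigcup_j range (c j)) t by rewrite clT.
    move=> /(_ O (open_nbhs_nbhs (conj Oop Ot)))[u [? ?]].
    by exists u.
have [s [[[cE Ks] _] cs sN]] := chain_union K_MAEC Ncl Tcompl.
(* A finite tuple from the union lies in a single stage, as the index order is total. *)
have common n (x : 'I_n -> T) : (forall k, (\bigcup_j range (c j)) (x k)) ->
    exists j (y : 'I_n -> N j), x = c j \o y.
  move=> xc.
  have [j jP] : exists j, forall k, range (c j) (x k).
    suff : forall m, (m <= n)%N ->
        exists j, forall k : 'I_n, (k < m)%N -> range (c j) (x k).
      by move=> /(_ n (leqnn n))[j jP]; exists j => k; exact: jP.
    elim=> [|m IH] mn; first by exists j0.
    have [j jP] := IH (ltnW mn); have [i _ [y _ yx]] := xc (Ordinal mn).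
    have up a b (ab : le a b) t : range (c a) t -> range (c b) t.
      move=> [z _ <-]; exists (e a b ab z) => //.
      exact: (completion_compatible Tcompl).
    have [ij|ji] := le_total i j; [exists j|exists i] => k;
      rewrite ltnS leq_eqVlt => /orP[/eqP km|/jP].
    - have -> : k = Ordinal mn by exact: val_inj.
      by apply: (up _ _ ij); exists y.
    - by [].
    - have -> : k = Ordinal mn by exact: val_inj.
      by exists y.
    - exact: up.
  have /choice[y yP] k : exists y, c j y = x k by have [y] := jP k; exists y.
  by exists j, y; apply/funext => k /=; rewrite yP.
have inclE : @embedding R L (Structure s) Q incl.
  apply: (@embedding_dense R L (Structure s) Q _ _ incl_iso clT)
    => [v x /common[j [y ->]]|p x /common[j [y ->]]].
  - rewrite -(embedding_fint (cE j)) incl_c (embedding_fint (fE j)).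
    by congr fint.
  - rewrite (embedding_pint (cE j)) -(embedding_pint (fE j)).
    by congr pint.
have inclY : @represents (Structure s) Q incl Y.
  split=> //; apply/seteqP; split=> [_ [t _ <-]|y Yy]; first exact: subspace_inclP.
  by exists (to_subspace (Yf j0 point) Ycl Yy).
split=> [|j|Z XZ]; first by exists (Structure s), incl.
  by exists (N j), (Structure s), (f j), incl, (c j).
have [_ [NZ [g gZ]]] := strong_sub_Kset (XZ j0).
have hS j : {h : N j -> NZ | strong K h /\ forall x, g (h x) = f j x}.
  by apply: cid; have [h hs hP] := represents_strong (fX j) gZ (XZ j); exists h.
have [_ gE gZ'] := gZ.
have YZ : Y `<=` Z.
  rewrite /Y closureE => y; apply; split; last first.
    by move=> z [j _]; exact: strong_sub_subset.
  by have [_ /Kset_closed] := strong_sub_Kset (XZ j0).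
have [|h hi hP] := embedding_lift inclE gE.
  by have [_ _ ->] := inclY; rewrite gZ'.
exists (Structure s), NZ, incl, g, h; split=> //.
apply: (sN NZ (fun j => sval (hS j))).
- move=> i j ij x; apply: (embedding_inj gE).
  by rewrite (svalP (hS j)).2 (svalP (hS i)).2 eP.
- by move=> j; exact: (svalP (hS j)).1.
- exact: (embedding_isometry hi).
- move=> j x; apply: (embedding_inj gE).
  by rewrite hP (svalP (hS j)).2 incl_c.
Qed.

End Chain.

End StrongSubsets.

(** * Well-orders *)

Section WellOrders.
Context (A : eqType) (le : rel A).
Hypothesis le_wo : wochoice.well_order le.

Lemma well_order_min (P : A -> Prop) : (exists a, P a) ->
  exists2 z, P z & forall a, P a -> le z a.
Proof.
move=> [a Pa]; have [|z [[Pz zmin] _]] := le_wo (A := [pred a | `[< P a >]]).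
  by exists a; exact/asboolP.
exists z; first exact/asboolP.
by move=> b Pb; apply: zmin; exact/asboolP.
Qed.

Lemma well_order_refl a : le a a.
Proof. by have [z -> /(_ a erefl)] := @well_order_min (eq^~ a) (ex_intro _ a erefl). Qed.

Lemma well_order_total a b : le a b \/ le b a.
Proof.
have [|z [->|->] zmin] := @well_order_min (fun c => c = a \/ c = b).
- by exists a; left.
- by left; apply: zmin; right.
- by right; apply: zmin; left.
Qed.

(** Both [a] and [b] are least in the pair, and [well_order] makes the least element unique. *)
Lemma well_order_antisym a b : le a b -> le b a -> a = b.
Proof.
move=> ab ba; have [|z [_ zuniq]] := le_wo (A := pred2 a b).
  by exists a; rewrite inE eqxx.
have aa := well_order_refl a; have bb := well_order_refl b.
rewrite -(zuniq a) ?(zuniq b)//.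
- by split=> [|c]; rewrite !inE ?eqxx ?orbT// => /orP[]/eqP->.
- by split=> [|c]; rewrite !inE ?eqxx ?orbT// => /orP[]/eqP->.
Qed.

Lemma well_order_trans b a c : le a b -> le b c -> le a c.
Proof.
move=> ab bc; have [|z zE zmin] := @well_order_min (fun d => [\/ d = a, d = b | d = c]).
  by exists a; constructor 1.
case: zE zmin => -> zmin; first by apply: zmin; constructor 3.
  by rewrite (well_order_antisym ab)//; apply: zmin; constructor 1.
by rewrite -(well_order_antisym bc)//; apply: zmin; constructor 2.
Qed.

Lemma well_order_sig (D : pred A) :
  wochoice.well_order (fun x y : {a | D a} => le (val x) (val y)).
Proof.
move=> B [x0 Bx0].
have [|z [x Bx <-] zmin] := @well_order_min (fun a => exists2 x, x \in B & val x = a).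
  by exists (val x0), x0.
have xmin y : y \in B -> le (val x) (val y) by move=> By; apply: zmin; exists y.
exists x; split=> // y [By ymin].
by apply: val_inj; apply: well_order_antisym; [exact: xmin|exact: ymin].
Qed.

Lemma well_order_ind (P : A -> Prop) :
  (forall a, (forall b, le b a -> b != a -> P b) -> P a) -> forall a, P a.
Proof.
move=> IH a; apply: contrapT => nPa.
have [|z nPz zmin] := @well_order_min (fun a => ~ P a); first by exists a.
apply: nPz; apply: IH => b bz b_neq_z; apply: contrapT => /zmin zb.
by move/eqP: b_neq_z; apply; exact: well_order_antisym.
Qed.

(** Nonemptiness of [D] supplies the bound when no entry of [s] lies in [D]. *)
Lemma well_order_seq_bound (D : set A) (s : seq A) : D !=set0 ->
  exists2 b, D b & forall a, a \in s -> D a -> le a b.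
Proof.
move=> D0; elim: s => [|a s [b Db bP]]; first by have [b] := D0; exists b.
have [Da|nDa] := pselect (D a); last first.
  by exists b => // c; rewrite inE => /orP[/eqP->|/bP].
have [ab|ba] := well_order_total a b; [exists b|exists a] => // c;
  rewrite inE => /orP[/eqP->//|/bP/[apply]].
- by [].
- by move=> ?; exact: well_order_refl.
- by move=> cb; exact: well_order_trans cb ba.
Qed.

End WellOrders.

(** * Directed unions indexed by finite sets *)

Section DirectedUnions.
Context (R : realType) (L : language) (K : structure_class R L).
Hypothesis K_MAEC : is_MAEC K.
Context (Q : structure R L) (A : choiceType) (Y : {fset A} -> set Q).
Hypothesis Y_strong : forall F G : {fset A},
  (F `<=` G)%fset -> strong_sub K (Y F) (Y G).

(** Extends [Y] from finite index sets to arbitrary ones; [hull_fset] gives the agreement. *)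
Let hull (S : set A) : set Q :=
  closure (\bigcup_(F in [set F : {fset A} | [set` F] `<=` S]) Y F).

Let hull_fset F : hull [set` F] = Y F.
Proof.
have [YK _] := strong_sub_Kset (Y_strong (fsubset_refl F)).
apply/seteqP; split; last first.
  by move=> y Yy; apply: subset_closure; exists F.
rewrite /hull closureE => y; apply; split; first exact: Kset_closed YK.
by move=> z [G /= GF]; apply: strong_sub_subset; apply: Y_strong; exact/fsubsetP.
Qed.

Let hull_mono (S S' : set A) : S `<=` S' -> hull S `<=` hull S'.
Proof.
move=> SS'; apply: closure_subset => y [F FS Fy].
by exists F => //; exact: subset_trans FS SS'.
Qed.

Context (le : rel A) (le_wo : wochoice.well_order le).

Let below b := [set a | le a b /\ a != b].

(** The induction hypothesis at an initial segment [D]. Carrying a finite set [F] lets the segment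
    up to and including [b] be read as [below b] plus a finite set, so successor and limit cases are
    uniform. *)
Let stage (D : set A) : Prop :=
  (forall F G : {fset A}, (F `<=` G)%fset ->
    strong_sub K (hull (D `|` [set` F])) (hull (D `|` [set` G]))) /\
  (forall b (F : {fset A}), D b ->
    strong_sub K (hull (below b `|` [set` F])) (hull (D `|` [set` F]))).

Let below_fset1U b c (F : {fset A}) :
  below c b -> below c `|` [set` (b |` F)%fset] = below c `|` [set` F].
Proof.
move=> cb; apply/seteqP; split=> a /= [ca|aF]; [by left| |by left|].
  by move: aF; rewrite !inE => /orP[/eqP->|aF]; [left|right].
by right; rewrite !inE aF orbT.
Qed.

(* The structure on D together with F is the union of the chain, over b in D,
   of the structures on b, the elements below b, and F. *)
Let stage_step (D : set A) : (forall b c, D c -> le b c -> D b) ->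
  (forall b, D b -> stage (below b)) -> stage D.
Proof.
move=> Ddown IH; have [->|/set0P[d0 Dd0]] := eqVneq D set0.
  by split=> [F G FG|b F []]; rewrite !set0U !hull_fset; exact: Y_strong.
pose J := {b | b \in D}.
pose X F (j : J) := hull (below (val j) `|` [set` (val j |` F)%fset]).
have DJ (j : J) : D (val j) by exact: set_mem (valP j).
have XS F (i j : J) : le (val i) (val j) -> strong_sub K (X F i) (X F j).
  move=> ij; have [eq_ij|neq_ij] := eqVneq (val i) (val j).
    have -> : i = j by exact: val_inj.
    apply: strong_sub_refl => //; have [st _] := IH _ (DJ j).
    by have [] := strong_sub_Kset (st _ _ (fsubset_refl (val j |` F)%fset)).
  (* Two moves: enlarge [below (val i)] to [below (val j)], which absorbs the point [val i], then
     add [val j] to the finite part. *)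
  have [st1 st2] := IH _ (DJ j); have ji : below (val j) (val i) by [].
  apply: (strong_sub_trans K_MAEC (st2 _ _ ji)); rewrite below_fset1U//.
  by apply: st1; exact: fsubsetU1.
have XE F : closure (\bigcup_j X F j) = hull (D `|` [set` F]).
  apply/seteqP; split.
    rewrite closureE => y; apply; split; first exact: closed_closure.
    move=> z [j _]; apply: hull_mono => a /= [[aj _]|].
      by left; apply: Ddown aj; exact: DJ.
    by rewrite !inE => /orP[/eqP->|aF]; [left; exact: DJ|right].
  apply: closure_subset => y [G /= GDF Gy].
  (* With [b] bounding the elements of [G] in [D], the whole of [G] lies in [below b], [b] and
     [F]. *)
  have [b Db bP] := well_order_seq_bound le_wo G (ex_intro _ d0 Dd0 : D !=set0).
  exists (exist _ b (mem_set Db)) => //; apply: subset_closure; exists G => //=.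
  move=> a aG; have [Da|aF] := GDF a aG; last by right; rewrite /= !inE aF orbT.
  have [->|ab] := eqVneq a b; first by right; rewrite /= !inE eqxx.
  by left; split=> //; exact: bP.
have chain F := @strong_chain R L K K_MAEC Q J
  (fun i j => le (val i) (val j)) (X F) (inhabits (exist _ d0 (mem_set Dd0)))
  (well_order_sig le_wo (D := fun b => b \in D))
  (fun j => well_order_refl le_wo (val j))
  (fun i j => well_order_total le_wo (val i) (val j)) (XS F).
split=> [F G FG|b F Db].
  have [_ _ lub] := chain F; have [_ ub _] := chain G.
  rewrite -!XE; apply: lub => j; apply: (strong_sub_trans K_MAEC _ (ub j)).
  by have [st _] := IH _ (DJ j); apply: st; exact: fsetUS.
have [_ ub _] := chain F; have [st _] := IH _ Db.
rewrite -XE; apply: (strong_sub_trans K_MAEC _ (ub (exist _ b (mem_set Db)))).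
by apply: st; exact: fsubsetU1.
Qed.

Let stage_below b : stage (below b).
Proof.
elim/(well_order_ind le_wo): b => b IH; apply: stage_step => [a c [cb c_neq_b] ac|a [ab a_neq_b]].
  split; first exact: (well_order_trans le_wo) cb.
  apply/eqP => ab; move/eqP: c_neq_b; apply; apply: (well_order_antisym le_wo) => //.
  by rewrite -ab.
exact: IH.
Qed.

Lemma Kset_directed_union_wo : Kset K (closure (\bigcup_F Y F)).
Proof.
have [st _] : stage setT by apply: stage_step => // b _; exact: stage_below.
have [+ _] := strong_sub_Kset (st _ _ (fsubset_refl fset0)).
by congr (Kset K (closure _)); apply/seteqP; split=> y [F _ Fy];
  exists F => // a _; left.
Qed.

End DirectedUnions.

Lemma Kset_directed_union (R : realType) (L : language) (K : structure_class R L)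
    (Q : structure R L) (A : choiceType) (Y : {fset A} -> set Q) :
  is_MAEC K ->
  (forall F G, (F `<=` G)%fset -> strong_sub K (Y F) (Y G)) ->
  Kset K (closure (\bigcup_F Y F)).
Proof.
move=> K_MAEC Y_strong; have [le le_wo] := wochoice.well_ordering_principle A.
exact: Kset_directed_union_wo le_wo.
Qed.

(** * Monotone families from downward Lowenheim-Skolem *)

Section LowenheimSkolem.
Context (R : realType) (L : language) (K : structure_class R L) (kappa : Type).
Hypothesis K_MAEC : is_MAEC K.
Hypothesis K_LS : is_LS_number K kappa.

(* kappa * nat has the cardinality of kappa; the factor nat makes it trivially
   stable under disjoint unions with kappa and countable unions. *)
Local Notation S := (kappa * nat)%type.

Lemma card_le_sub_range (S T : Type) (X : set T) :
  X !=set0 -> X #<= [set: S] -> exists y : S -> T, X `<=` range y.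
Proof.
move=> [x0 Xx0] /card_leP[g].
have /choice[y yP] s : exists x, forall z : X, val (g z) = s -> x = val z.
  have [[z gz]|nz] := pselect (exists z : X, val (g z) = s).
    exists (val z) => z'; rewrite -gz => /val_inj gzz'.
    by congr val; apply: ('inj_g); rewrite ?inE.
  by exists x0 => z gz; exfalso; apply: nz; exists z.
exists y => x Xx; exists (val (g (exist _ x (mem_set Xx)))) => //.
exact: (yP _ (exist _ x (mem_set Xx))).
Qed.

(** The density character of [range a] is at most the size of [S], and adding [kappa] keeps this
    bound, so a dense subset of [N] is enumerated by [S]. *)
Lemma LS_enum (M : structure R L) (a : S -> M) : K M ->
  exists x : S -> M, range a `<=` closure (range x) /\
    strong_sub K (closure (range x)) [set: M].
Proof.
move=> KM; have [N [f [KN fs af [D [E [[_ clD _] [Ea aE Emin] DE]]]]]] :=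
  LS_downward K_LS KM (range a).
have [k0 _] : [set: kappa] !=set0 by exact/infinite_setN0/(LS_infinite K_LS).
(* [E] is minimal, and [range a] is itself dense in its closure. *)
have ES : E #<= [set: S].
  apply: card_le_trans (Emin (range a) _ _) (card_image_le _ _) => //.
  exact: subset_closure.
have E0 : E !=set0.
  have /aE/(_ setT filterT)[e []] : closure (range a) (a (k0, 0%N)).
    by apply: subset_closure; exists (k0, 0%N).
  by exists e.
have [u uE] := card_le_sub_range E0 ES.
have D0 : D !=set0.
  have /clD/(_ setT filterT)[e []] : closure [set: N] point.
    exact: subset_closure.
  by exists e.
have [|y yD] := @card_le_sub_range S _ D D0.
  apply: card_le_trans DE _.
  (* Level 0 of the factor [nat] lists [kappa]; level [m.+1] lists level [m] of [u], hence all of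
     [E]. *)
  pose w (s : S) : M + kappa := if s.2 is m.+1 then inl (u (s.1, m)) else inr s.1.
  apply: (@card_le_trans _ _ _ (range w)); last exact: card_image_le.
  apply: subset_card_le => _ [[e /uE[[k m] _ <-] <-]|[k _ <-]].
    by exists (k, m.+1).
  by exists (k, 0%N).
have fi : isometry f by exact/embedding_isometry/(strong_embedding K_MAEC fs).
exists (f \o y); have -> : closure (range (f \o y)) = range f.
  apply/seteqP; split.
    rewrite closureE => z; apply; split; first exact: isometry_closed_range.
    by move=> _ [s _ <-]; exists (y s).
  move=> _ [n _ <-]; apply/closure_mdistP => e e0.
  have /clD/closure_mdistP/(_ _ e0)[d /yD[s _ <-] nd] : closure [set: N] n.
    exact: subset_closure.
  by exists (f (y s)); [exists s|rewrite fi].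
by split=> //; exact: strong_sub_range.
Qed.

(** The factor [nat] codes a list position together with an old index, so finitely many enumerations
    fit into one. Invalid codes read as [(0, 0)], and positions past the end give [point]. *)
Definition join_enum (T : pointedType) (fs : seq (S -> T)) : S -> T :=
  fun s => let: (k, m) := odflt (0, 0)%N (choice.unpickle s.2) in
    nth (fun=> point) fs k (s.1, m).

Lemma join_enum_sub (T : pointedType) (fs : seq (S -> T)) k :
  range (nth (fun=> point) fs k) `<=` range (join_enum fs).
Proof.
move=> _ [[a m] _ <-]; exists (a, choice.pickle (k, m)) => //.
by rewrite /join_enum /= choice.pickleK.
Qed.

(** Every member is strong in [M], so by coherence it is enough that the closures increase; each
    enumeration therefore takes in those of all proper subsets. *)
Lemma LS_family (M : structure R L) (A : choiceType) (v : A -> M) : K M ->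
  exists x : {fset A} -> S -> M,
    (forall F a, a \in F -> closure (range (x F)) (v a)) /\
    (forall F G, (F `<=` G)%fset ->
      strong_sub K (closure (range (x F))) (closure (range (x G)))).
Proof.
move=> KM; have /choice[ls lsP] := fun a => @LS_enum M a KM.
pose next (F : {fset A}) (fs : seq (S -> M)) :=
  ls (join_enum ([seq (fun=> v a) | a <- enum_fset F] ++ fs)).
(* [n] is fuel: [E n F] is final once [n] reaches the size of [F]. The power set contains [F]
   itself, and [E m F] with too little fuel only adds harmless points. *)
pose E := fix E n F := if n is m.+1 then
    if (#|` F| <= m)%N then E m F else next F [seq E m G | G <- enum_fset (fpowerset F)]
  else next F [::].
pose x F := E #|` F| F.
have E_ge n F : (#|` F| <= n)%N -> E n F = x F.
  elim: n => [|n IH] /=; first by rewrite leqn0 /x => /eqP ->.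
  move=> Fn; case: (leqP #|` F| n) => [/IH//|nF].
  have cF : #|` F| = n.+1 by apply/eqP; rewrite eqn_leq Fn.
  by rewrite /x cF /= cF ltnn.
have xE F : exists fs, x F = next F fs.
  rewrite /x; case cF : #|` F| => [|n]; first by exists [::].
  by rewrite /= cF ltnn; eexists.
have xT F : strong_sub K (closure (range (x F))) [set: M].
  by have [fs ->] := xE F; have [] := lsP (join_enum ([seq (fun=> v a) | a <- enum_fset F] ++ fs)).
exists x; split=> [F a aF|F G].
  have [fs ->] := xE F; apply: (lsP _).1; apply: (join_enum_sub (k := index a F)).
  rewrite nth_cat size_map index_mem aF (nth_map a) ?index_mem// nth_index//.
  by have [k0 _] : [set: kappa] !=set0; [exact/infinite_setN0/(LS_infinite K_LS)|exists (k0, 0%N)].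
rewrite fsubEproper => /orP[/eqP->|FG].
  by apply: strong_sub_refl => //; have [] := strong_sub_Kset (xT G).
apply: (strong_sub_coherence K_MAEC (xT F) (xT G)).
rewrite closureE => y; apply; split; first exact: closed_closure.
have cFG := fproper_ltn_card FG.
rewrite [x G]/x; case cG : #|` G| cFG => [//|n]; rewrite ltnS => cF.
rewrite /= cG ltnn => z zF; apply: (lsP _).1.
have FP : F \in enum_fset (fpowerset G) by rewrite fpowersetE fproper_sub.
(* The enumerations of subsets come after the constant ones, one for each element of [G]. *)
apply: (join_enum_sub (k := size (enum_fset G) + index F (enum_fset (fpowerset G)))).
rewrite nth_cat size_map ltnNge leq_addr /= addKn (nth_map F) ?index_mem//.
by rewrite nth_index// E_ge.
Qed.

End LowenheimSkolem.

(** * Transfer between enumerations by distances *)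

Section Matching.
Context (R : realType) (S : Type).

(** When [y] and [x] have the same mutual distances and [T'] is complete, this is, on the closure of
    [range y], the graph of the isometry taking each [y s] to [x s]. As an [S]-indexed conjunction,
    it can be tested on almost all coordinates. *)
Definition matches (T T' : metricType R) (y : S -> T) (x : S -> T') a p : Prop :=
  forall s, mdist a (y s) = mdist p (x s).

(** Only [a] has to be a limit: if [y s] is near [a], then [x s] is equally near [p], and the
    distances from [y s] to [b] and from [x s] to [q] agree. *)
Lemma matches_mdist (T T' : metricType R) (y : S -> T) (x : S -> T') a b p q :
  closure (range y) a -> matches y x a p -> matches y x b q ->
  mdist a b = mdist p q.
Proof.
move=> /closure_mdistP ya ap bq; apply/eqP; rewrite eq_le.
apply/andP; split; apply/ler_addgt0Pr => e e0;
  have [_ [s _ <-] as_lt] := ya (e / 2) (divr_gt0 e0 (ltr0Sn _ 1)).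
- have := metric_triangle a (y s) b; have := metric_triangle q p (x s).
  move: as_lt (ap s) (bq s); rewrite (metric_sym (y s)) (metric_sym q p); lra.
- have := metric_triangle p (x s) q; have := metric_triangle b a (y s).
  move: as_lt (ap s) (bq s); rewrite (metric_sym (x s)) (metric_sym b a); lra.
Qed.

Lemma matches_unique (T T' : metricType R) (y : S -> T) (x : S -> T') a p q :
  closure (range y) a -> matches y x a p -> matches y x a q -> p = q.
Proof.
move=> ya ap aq; apply: mdist_positivity.
by rewrite -(matches_mdist ya ap aq) mdistxx.
Qed.

(** The witness is the limit of [x s] as [y s] tends to [a]. *)
Lemma matches_exists (T : metricType R) (T' : completeMetricType R)
    (y : S -> T) (x : S -> T') a :
  (forall s, matches y x (y s) (x s)) -> closure (range y) a ->
  exists2 p, closure (range x) p & matches y x a p.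
Proof.
move=> yx /closure_mdistP ya.
pose F := filter_from [set e : R | 0 < e] (fun e => x @` [set s | mdist a (y s) < e]).
have FF : ProperFilter F.
  apply: filter_from_proper; last first.
    by move=> e /= /ya[_ [s _ <-] as_lt]; exists (x s), s.
  apply: filter_from_filter; first by exists 1 => /=.
  move=> d e d0 e0; exists (Num.min d e); first by rewrite /= lt_min d0.
  by move=> _ [s /= + <-]; rewrite lt_min => /andP[]; split; exists s.
have /cauchy_cvg/cvg_ex[p Fp] : cauchy F.
  apply/cauchyP => e e0; have e20 : 0 < e / 2 by rewrite divr_gt0.
  have [_ [s _ <-] as_lt] := ya _ e20; exists (x s); exists (e / 2) => // _ [t /= at_lt <-].
  rewrite ballEmdist /= -yx (le_lt_trans (metric_triangle _ a _))//.
  by rewrite [e]splitr ltrD// metric_sym.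
have near_p (e : R) : 0 < e -> exists2 s, mdist p (x s) < e & mdist a (y s) < e.
  move=> e0; have /filter_ex[q []] : F (ball p e `&` x @` [set s | mdist a (y s) < e]).
    by apply: filterI; [exact/Fp/nbhsx_ballx|exists e].
  by rewrite ballEmdist /= => pq [s ? qE]; exists s; rewrite ?qE.
exists p; first by apply/closure_mdistP => e /near_p[s ps _]; exists (x s).
move=> t; apply/eqP; rewrite eq_le.
apply/andP; split; apply/ler_addgt0Pr => e e0;
  have [s ps as_lt] := near_p (e / 2) (divr_gt0 e0 (ltr0Sn _ 1)).
- have := metric_triangle a (y s) (y t); have := metric_triangle (x s) p (x t).
  by move: ps as_lt (yx s t); rewrite (metric_sym (x s) p); lra.
- have := metric_triangle p (x s) (x t); have := metric_triangle (y s) a (y t).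
  by move: ps as_lt (yx s t); rewrite (metric_sym (y s) a); lra.
Qed.

(** Function values at enumerated points need not be enumerated, so the hypothesis on them is a
    match. Each point goes to its match, and the symbols are compared on the dense set of enumerated
    points. *)
Lemma matches_embedding (L : language) (N A Q : structure R L)
    (f : N -> A) (y : S -> A) (x : S -> Q) :
  embedding f -> range f = closure (range y) ->
  (forall s, matches y x (y s) (x s)) ->
  (forall v (a : 'I_(farity v) -> S),
    matches y x (fint A (fun k => y (a k))) (fint Q (fun k => x (a k)))) ->
  (forall v (a : 'I_(parity v) -> S),
    pint Q (fun k => x (a k)) = pint A (fun k => y (a k))) ->
  exists phi : N -> Q, [/\ embedding phi, range phi = closure (range x) &
    forall n, matches y x (f n) (phi n)].
Proof.
move=> fE fy yx yxf yxp.
have yf n : closure (range y) (f n) by rewrite -fy; exists n.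
have /choice[phi phiP] n : exists p, closure (range x) p /\ matches y x (f n) p.
  by have [p xp np] := matches_exists yx (yf n); exists p.
have phi_iso : isometry phi.
  move=> m n; rewrite -(embedding_isometry fE); apply/esym.
  exact: matches_mdist (yf m) (phiP m).2 (phiP n).2.
have phi_y n s : f n = y s -> phi n = x s.
  by move=> ns; apply: matches_unique (yf n) (phiP n).2 _; rewrite ns.
pose D := [set n | exists s, f n = y s].
have fD s : exists n, f n = y s.
  have [n _ ns] : range f (y s) by rewrite fy; apply: subset_closure; exists s.
  by exists n.
have clD : closure D = setT.
  apply/seteqP; split=> // n _; apply/closure_mdistP => e e0.
  have /closure_mdistP/(_ _ e0)[_ [s _ <-]] := yf n.
  by have [m ms] := fD s; rewrite -ms (embedding_isometry fE) => nm; exists m => //; exists s.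
exists phi; split=> [||n]; last exact: (phiP n).2.
  apply: (embedding_dense phi_iso clD) => v z /choice[a za].
    apply: matches_unique (yf _) (phiP _).2 _; rewrite (embedding_fint fE).
    have -> : f \o z = fun k => y (a k) by apply/funext => k; exact: za.
    have -> : phi \o z = fun k => x (a k) by apply/funext => k; exact: phi_y.
    exact: yxf.
  have -> : phi \o z = fun k => x (a k) by apply/funext => k; exact: phi_y.
  rewrite yxp -(embedding_pint fE); congr pint; apply/funext => k.
  by rewrite /= za.
apply/seteqP; split=> [_ [n _ <-]|]; first exact: (phiP n).1.
rewrite closureE => q; apply; split; first exact: isometry_closed_range.
by move=> _ [s _ <-]; have [n ns] := fD s; exists n => //; exact: phi_y.
Qed.

End Matching.

(** * Ultrafilters closed under indexed intersections *)

Section CompleteUltrafilters.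
Context (I : Type) (U : set_system I) (UU : UltraFilter U).

Definition closed_under_bigcap (S : Type) : Prop :=
  forall A : S -> set I, (forall s, U (A s)) -> U [set i | forall s, A s i].

Lemma succ_complete_bigcap (kappa S : Type) :
  succ_complete kappa U -> [set: S] #<= [set: kappa] -> closed_under_bigcap S.
Proof.
move=> Uk Sk A UA.
have : U (\bigcap_(B in range A) B).
  apply: Uk => [_ [s _ <-] //|]; exact: card_le_trans (card_image_le _ _) Sk.
by apply: filterS => i Ai s; apply: Ai; exists s.
Qed.

Lemma countably_complete_bigcap : countably_complete U -> closed_under_bigcap nat.
Proof. by move=> Ucc A /Ucc; apply: filterS => i Ai s; exact: Ai. Qed.

Lemma prod_bigcap (S T : Type) : closed_under_bigcap S -> closed_under_bigcap T ->
  closed_under_bigcap (S * T).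
Proof.
move=> US UT A UA.
have : U [set i | forall s t, A (s, t) i] by apply: US => s; exact: UT.
by apply: filterS => i Ai [].
Qed.

(** Splitting off the first coordinate gives iterated intersections over [S], avoiding cardinal
    arithmetic of powers. *)
Lemma tuple_bigcap (S : Type) n :
  closed_under_bigcap S -> closed_under_bigcap ('I_n -> S).
Proof.
move=> US; elim: n => [|n IH] A UA.
  pose a0 : 'I_0 -> S := fun k => False_rect S (notF (valP k)).
  apply: filterS (UA a0) => i Ai a; suff -> : a = a0 by [].
  by apply/funext => -[].
pose cons s (a : 'I_n -> S) k := oapp a s (unlift ord0 k).
have : U [set i | forall s a, A (cons s a) i] by apply: US => s; exact: IH.
apply: filterS => i Ai a; have := Ai (a ord0) (fun k => a (lift ord0 k)).
congr (A _ i); apply/funext => k; rewrite /cons.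
by case: unliftP => [j|] ->.
Qed.

End CompleteUltrafilters.

(** * Transfer from almost every coordinate to the ultraproduct *)

Section UltraproductMatching.
Context (R : realType) (L : language) (I : Type) (U : set_system I).
Context (UU : UltraFilter U) (Ucc : countably_complete U).
Context (M : I -> structure R L) (S : Type).
Hypothesis S_small : closed_under_bigcap U S.

Local Notation upi := (upi UU Ucc (M := M)).
Local Notation Q := (metric_ultraproduct UU Ucc M).

Lemma ultra_matches (x : S -> forall i, M i) (a : forall i, M i) :
  U [set i | matches (x^~ i) (fun s => upi (x s) : Q) (a i) (upi a)].
Proof. by apply: S_small => s; exact: mdist_upiE. Qed.

Hypothesis fsym_small : closed_under_bigcap U (fsym L).
Hypothesis psym_small : closed_under_bigcap U (psym L).

(** The matching conditions of [matches_embedding] involve only [x] and [i], so one set of [U]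
    serves all [N] and [f] without intersecting over them. *)
Lemma ultra_embedding (x : S -> forall i, M i) :
  U [set i | forall (N : structure R L) (f : N -> M i),
    embedding f -> range f = closure (range (x^~ i)) ->
    exists phi : N -> Q, [/\ embedding phi,
      range phi = closure (range (fun s => upi (x s) : Q)) &
      forall n, matches (x^~ i) (fun s => upi (x s) : Q) (f n) (phi n)]].
Proof.
have Ux : U [set i | forall s,
    matches (x^~ i) (fun t => upi (x t) : Q) (x s i) (upi (x s))].
  by apply: S_small => s; exact: ultra_matches.
have Uf : U [set i | forall v (a : 'I_(farity v) -> S),
    matches (x^~ i) (fun t => upi (x t) : Q) (fint (M i) (fun k => x (a k) i))
      (fint Q (fun k => upi (x (a k))))].
  apply: fsym_small => v; apply: (tuple_bigcap UU S_small) => a.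
  by rewrite [fint Q _]uprod_fintE; exact: ultra_matches.
have Up : U [set i | forall v (a : 'I_(parity v) -> S),
    pint Q (fun k => upi (x (a k))) = pint (M i) (fun k => x (a k) i)].
  apply: psym_small => v; apply: (tuple_bigcap UU S_small) => a.
  rewrite [pint Q _]uprod_pintE.
  by apply: filterS (ulimE UU Ucc (fun i => pint (M i) (fun k => x (a k) i))).
apply: filterS3 Ux Uf Up => i xi fi pi N f fE fx.
exact: matches_embedding.
Qed.

End UltraproductMatching.

(** * The directed system inside the ultraproduct *)

Theorem mainTheorem1 (R : realType) (L : language) (K : structure_class R L)
  (kappa : Type) (K_MAEC : is_MAEC K) (K_LS : is_LS_number K kappa)
  (I : Type) (M : I -> structure R L) (M_K : forall i : I, member K (M i))
  (U : set_system I) (U_ultra : UltraFilter U)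
  (U_complete : succ_complete kappa U) :
  member K (metric_ultraproduct U_ultra
    (succ_complete_countably (LS_infinite K_LS) U_complete) M).
Proof.
set Ucc := succ_complete_countably _ _.
set Q := metric_ultraproduct _ _ _; pose S := (kappa * nat)%type.
have small T : [set: T] #<= [set: kappa] -> closed_under_bigcap U T.
  exact: succ_complete_bigcap.
have S_small : closed_under_bigcap U S.
  apply: prod_bigcap; first by apply: small; exact: card_lexx.
  exact: countably_complete_bigcap.
have sum_small := small _ (LS_language K_LS).
have f_small : closed_under_bigcap U (fsym L).
  move=> A UA; have : U [set i | forall v : fsym L + psym L,
      (if v is inl f then A f else setT) i].
    by apply: sum_small => -[f|p] //; exact: filterT.
  by apply: filterS => i Ai f; exact: (Ai (inl f)).
have p_small : closed_under_bigcap U (psym L).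
  move=> A UA; have : U [set i | forall v : fsym L + psym L,
      (if v is inr p then A p else setT) i].
    by apply: sum_small => -[f|p] //; exact: filterT.
  by apply: filterS => i Ai p; exact: (Ai (inr p)).
have [x [xmem xstrong]] : exists x : {fset Q} -> S -> forall i, M i,
    (forall i F p, p \in F -> closure (range (x F ^~ i)) (repr p i)) /\
    (forall i F G, (F `<=` G)%fset ->
      strong_sub K (closure (range (x F ^~ i))) (closure (range (x G ^~ i)))).
  pose H i := cid (LS_family K_MAEC K_LS (fun p : Q => repr p i) (M_K i)).
  exists (fun F s i => projT1 (H i) F s).
  by split=> i; [exact: (projT2 (H i)).1|exact: (projT2 (H i)).2].
pose X F s : Q := upi U_ultra Ucc (x F s).
have emb F := ultra_embedding U_ultra Ucc S_small f_small p_small (x F).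
apply: (Kset_member K_MAEC).
suff <- : closure (\bigcup_F closure (range (X F))) = [set: Q].
  apply: (Kset_directed_union K_MAEC) => F G FG.
  (* Points enumerated for [G] also match over the enumeration for [F]; this makes [phi] and [phi'],
     built from separate enumerations, agree along [h]. *)
  have cross : U [set i | forall t, matches (x F ^~ i) (X F) (x G t i) (X G t)].
    by apply: (S_small) => t; exact: ultra_matches.
  (* A single good coordinate is enough, since [strong_sub] asks for one pair of representatives. *)
  have [i [[/= embF embG] FGi]] :=
    filter_ex (filterI (filterI (emb F) (emb G)) cross).
  have [N [N' [f [f' [h [[KN fE fF] [KN' f'E f'G] hs hP]]]]]] := xstrong i _ _ FG.
  have [phi [phiE phiF phiP]] := embF _ _ fE fF.
  have [phi' [phi'E phi'G phi'P]] := embG _ _ f'E f'G.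
  exists N, N', phi, phi', h; split=> // n.
  have f'n : closure (range (x G ^~ i)) (f' (h n)) by rewrite -f'G; exists (h n).
  apply: matches_unique f'n (phi'P (h n)) _ => t; rewrite hP.
  apply: matches_mdist (phiP n) (FGi t).
  by rewrite -fF; exists n.
apply/seteqP; split=> // p _; apply: subset_closure; exists [fset p]%fset => //.
(* At one coordinate [i] the distances from [repr p i] to the enumeration are those from [p] in the
   ultraproduct, so approximations transfer. *)
have /filter_ex[i /= pi] := ultra_matches U_ultra Ucc S_small (x [fset p]%fset) (repr p).
have /closure_mdistP pX := xmem i _ p (fset11 p).
apply/closure_mdistP => e /pX[_ [s _ <-]]; rewrite pi upi_repr => ps.
by exists (X [fset p]%fset s) => //; exists s.
Qed.
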